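(* Let $\mathbb{K}$ be a positive commutative monoid and let $H$ be a hypergraph. The following are equivalent: (1) $H$ is acyclic; (2) $H$ has the local-to-global consistency property up to the free cover of $\mathbb{K}$; (3) $H$ has the local-to-global consistency property up to some cover of $\mathbb{K}$.
   Context: Positive: $p+q=0\Rightarrow p=q=0$; monoids have at least two elements. Attributes have domains (arbitrary sets); for a finite attribute set $X$, a $\mathbb{K}$-relation over $X$ is a map $R$ from $X$-tuples to $K$ with finite support $R'$; $t[Y]$ is restriction; marginals $R[Y](t)=\sum_{r\in R',r[Y]=t}R(r)$. With $R_i$ over $X_i$, a collection is pairwise consistent if every two $R_i,R_j$ have some $W$ over $X_i\cup X_j$ with $W[X_i]=R_i,W[X_j]=R_j$, globally consistent if some $W$ over $\bigcup_i X_i$ has $W[X_i]=R_i$ for all $i$. A cover of $\mathbb{K}$ is a pair $(\mathbb{K}^*,h)$, $\mathbb{K}^*$ a positive commutative monoid and $h:\mathbb{K}^*\to\mathbb{K}$ a surjective homomorphism; an $h$-lift of $R$ is a $\mathbb{K}^*$-relation $R^*$ with $h\circ R^*=R$. A collection is pairwise consistent up to the cover if some $h$-lifts $R_1^*,\dots,R_m^*$ form a pairwise consistent collection of $\mathbb{K}^*$-relations. A hypergraph with hyperedges $X_1,\dots,X_m$ (vertices as attributes) has the local-to-global consistency property up to the cover if every collection $R_1(X_1),\dots,R_m(X_m)$ of $\mathbb{K}$-relations that is pairwise consistent up to the cover is globally consistent. The free cover of $\mathbb{K}$ is $h:\mathbb{F}(K^+)\to\mathbb{K}$ where $K^+=K\setminus\{0\}$,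 $\mathbb{F}(K^+)$ is the free commutative monoid generated by $K^+$ (the finitely supported maps $K^+\to\mathbb{Z}^{\ge0}$ under pointwise addition), and $h$ is the unique homomorphism extending the identity on $K^+$. A hypergraph is acyclic (Beeri–Fagin–Maier–Yannakakis) iff it has a join tree: a tree on its hyperedges such that for each vertex the hyperedges containing it form a connected subtree. *)

(* Defs.v *)
From mathcomp Require Import all_boot.
From Stdlib Require Lists.List.
From Stdlib Require Import ClassicalEpsilon.
Set Implicit Arguments. Unset Strict Implicit. Unset Printing Implicit Defensive.

Record cmon := CMon { cm_car :> Type; cm_zero : cm_car;
                      cm_add : cm_car -> cm_car -> cm_car }.

Definition is_pcmonoid (K : cmon) : Prop :=
  (forall a b c : K, cm_add a (cm_add b c) = cm_add (cm_add a b) c) /\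
  (forall a b : K, cm_add a b = cm_add b a) /\
  (forall a : K, cm_add (cm_zero K) a = a) /\
  (forall a b : K, cm_add a b = cm_zero K -> a = cm_zero K /\ b = cm_zero K) /\
  (exists a b : K, a <> b).

Fixpoint lsum (K : cmon) (T : Type) (f : T -> K) (l : list T) : K :=
  match l with
  | nil => cm_zero K
  | cons x l' => cm_add (f x) (lsum f l')
  end.

Definition finsum (K : cmon) (T : Type) (f : T -> K) : K :=
  lsum f (epsilon (inhabits nil)
            (fun l : list T => List.NoDup l /\
               forall x, f x <> cm_zero K -> List.In x l)).

Section Rel.
Variables (V : finType) (D : V -> Type) (K : cmon).

Definition atuple (X : {set V}) := forall v : V, v \in X -> D v.

Definition restr (X Y : {set V}) (H : Y \subset X) (t : atuple X) : atuple Y :=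
  fun v hv => t v (subsetP H v hv).

Record krel (X : {set V}) := KRel {
  krel_fun :> atuple X -> K;
  krel_fin : exists l : list (atuple X),
               forall t, krel_fun t <> cm_zero K -> List.In t l }.

Definition marg (X Y : {set V}) (H : Y \subset X) (R : krel X) (t : atuple Y) : K :=
  finsum (fun r : atuple X =>
            if excluded_middle_informative (restr H r = t) then R r else cm_zero K).

Lemma sub_bigcup m (X : 'I_m -> {set V}) (i : 'I_m) :
  X i \subset \bigcup_(j < m) X j.
Proof. exact: (bigcup_sup i (erefl true)). Qed.

Definition pw_consistent m (X : 'I_m -> {set V}) (R : forall i, krel (X i)) : Prop :=
  forall i j : 'I_m, exists W : krel (X i :|: X j),
    (forall t, marg (subsetUl (X i) (X j)) W t = R i t) /\
    (forall t, marg (subsetUr (X i) (X j)) W t = R j t).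

Definition gl_consistent m (X : 'I_m -> {set V}) (R : forall i, krel (X i)) : Prop :=
  exists W : krel (\bigcup_(j < m) X j),
    forall (i : 'I_m) (t : atuple (X i)), marg (sub_bigcup X i) W t = R i t.

End Rel.

Definition is_hom (Ks K : cmon) (h : Ks -> K) : Prop :=
  h (cm_zero Ks) = cm_zero K /\ forall a b : Ks, h (cm_add a b) = cm_add (h a) (h b).

Definition is_cover (Ks K : cmon) (h : Ks -> K) : Prop :=
  is_pcmonoid Ks /\ is_hom h /\ (forall k : K, exists a : Ks, h a = k).

Definition pw_consistent_up_to (V : finType) (D : V -> Type) (Ks K : cmon)
  (h : Ks -> K) m (X : 'I_m -> {set V}) (R : forall i, krel D K (X i)) : Prop :=
  exists Rs : forall i, krel D Ks (X i),
    (forall i (t : atuple D (X i)), h (Rs i t) = R i t) /\ pw_consistent Rs.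

Definition LTG_up_to (Ks K : cmon) (h : Ks -> K) (V : finType) m
  (X : 'I_m -> {set V}) : Prop :=
  forall (D : V -> Type) (R : forall i, krel D K (X i)),
    pw_consistent_up_to h R -> gl_consistent R.

Definition Kplus (K : cmon) := {k : K | k <> cm_zero K}.

Definition fin_nat (T : Type) (f : T -> nat) : Prop :=
  exists l : list T, forall x, f x <> 0 -> List.In x l.

Lemma fin_nat0 (T : Type) : fin_nat (fun _ : T => 0).
Proof. by exists nil => x. Qed.

Lemma fin_natD (T : Type) (f g : T -> nat) :
  fin_nat f -> fin_nat g -> fin_nat (fun x => Nat.add (f x) (g x)).
Proof.
move=> [l1 H1] [l2 H2]; exists (l1 ++ l2)%list => x Hx.
apply List.in_or_app; case E: (f x) => [|n] in Hx *.
- by right; apply: H2.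
- by left; apply: H1; rewrite E.
Qed.

Definition free_car (K : cmon) := {f : Kplus K -> nat | fin_nat f}.

Definition free_add (K : cmon) (f g : free_car K) : free_car K :=
  exist _ (fun x => Nat.add (proj1_sig f x) (proj1_sig g x))
        (fin_natD (proj2_sig f) (proj2_sig g)).

Definition free_mon (K : cmon) : cmon :=
  @CMon (free_car K) (exist _ (fun _ => 0) (@fin_nat0 (Kplus K))) (@free_add K).

Fixpoint nsmul (K : cmon) (n : nat) (a : K) : K :=
  match n with 0 => cm_zero K | S n' => cm_add a (nsmul n' a) end.

(* the homomorphism extending the identity on K^+ : f |-> sum_x f(x) . x *)
Definition free_hom (K : cmon) (f : free_mon K) : K :=
  finsum (fun x : Kplus K => nsmul (proj1_sig f x) (proj1_sig x)).

Definition is_tree m (E : rel 'I_m) : Prop :=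
  (forall i j, E i j = E j i) /\ (forall i, ~~ E i i) /\
  (forall i j, connect E i j) /\
  (* every edge is a bridge, i.e. the graph has no cycle *)
  (forall i j, E i j ->
     ~~ connect (fun a b => E a b &&
                  ~~ (((a == i) && (b == j)) || ((a == j) && (b == i)))) i j).

Definition acyclic (V : finType) m (X : 'I_m -> {set V}) : Prop :=
  exists E : rel 'I_m, is_tree E /\
    forall (v : V) (i j : 'I_m), v \in X i -> v \in X j ->
      connect (fun a b => E a b && (v \in X b)) i j.

(* Main.v *)
Require Import Defs.
From mathcomp Require Import all_boot all_algebra.
From Stdlib Require Lists.List Sorting.Permutation.
From Stdlib Require Import ClassicalEpsilon FunctionalExtensionality ProofIrrelevance.
Set Implicit Arguments. Unset Strict Implicit. Unset Printing Implicit Defensive.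

(** A relation over the free monoid on K^+ is a finite multiset of pairs (k, t), and
    marginals restrict the tuples t.  Two such multisets with equal marginals can be
    reordered so that the marginals agree entry by entry, and then glued entrywise.
    Doing this along a join tree glues pairwise consistent free relations into one
    multiset, whose image under h is the global witness.

    Conversely, run the Graham reduction (delete a vertex lying in a single edge,
    delete an edge contained in another one).  If it ends with at most one edge,
    undoing it builds a join tree.  Otherwise the remaining edges each receive a
    linear equation over a prime field F_p, p larger than the number of edges, with
    nonzero coefficients summing to zero at each vertex and with right-hand sides
    summing to one.  No assignment satisfies all of them, but any two have
    equidistributed solutions, so that the weighted solution sets are pairwise
    consistent over every positive monoid, hence over every cover. *)

Local Notation Permutation := Permutation.Permutation.
Local Notation In := List.In.
Local Notation NoDup := List.NoDup.

(** * Conditional values and duplicate-free covering lists *)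

(** Convertible to the conditional written inline in [marg], so a marginal can be restated with
    [guard] by a mere change of form. *)
Definition guard (K : cmon) (P : Prop) (k : K) : K :=
  if excluded_middle_informative P then k else cm_zero K.

Lemma guardT (K : cmon) (P : Prop) (k : K) : P -> guard P k = k.
Proof. by rewrite /guard; case: excluded_middle_informative. Qed.

Lemma guardF (K : cmon) (P : Prop) (k : K) : ~ P -> guard P k = cm_zero K.
Proof. by rewrite /guard; case: excluded_middle_informative. Qed.

Lemma guard0 (K : cmon) (P : Prop) : guard P (cm_zero K) = cm_zero K.
Proof. by rewrite /guard; case: excluded_middle_informative. Qed.

Lemma guard_iff (K : cmon) (P Q : Prop) (k : K) :
  (P <-> Q) -> guard P k = guard Q k.
Proof.
rewrite /guard => -[PQ QP]; case: excluded_middle_informative => p;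
  case: excluded_middle_informative => q //; [case: q|case: p]; auto.
Qed.

Lemma guard_and (K : cmon) (P Q : Prop) (k : K) :
  guard P (guard Q k) = guard (P /\ Q) k.
Proof.
case: (excluded_middle_informative P) => p.
  by rewrite guardT //; apply: guard_iff; tauto.
by rewrite guardF // guardF //; tauto.
Qed.

Lemma guard_hom (Ks K : cmon) (h : Ks -> K) (P : Prop) (k : Ks) :
  is_hom h -> h (guard P k) = guard P (h k).
Proof. by move=> [h0 _]; rewrite /guard; case: excluded_middle_informative. Qed.

Definition ceq_dec (T : Type) (x y : T) : {x = y} + {x <> y} :=
  excluded_middle_informative (x = y).

Lemma nodup_cover (T : Type) (P : T -> Prop) :
  (exists l : list T, forall x, P x -> In x l) ->
  exists l : list T, NoDup l /\ forall x, P x -> In x l.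
Proof.
move=> [l Hl]; exists (List.nodup (@ceq_dec T) l); split.
  exact: List.NoDup_nodup.
by move=> x /Hl; rewrite List.nodup_In.
Qed.

Lemma nat_pcmonoid : is_pcmonoid (@CMon nat 0 Nat.add).
Proof.
split; first exact: addnA.
split; first exact: addnC.
split; first exact: add0n.
split; last by exists 0, 1.
by move=> [|a] [|b].
Qed.

(** * Finite sums in a positive commutative monoid *)

Section FiniteSums.
Variables (K : cmon) (HK : is_pcmonoid K).

Let addA : associative (@cm_add K). Proof. exact: (proj1 HK). Qed.
Let addC : commutative (@cm_add K). Proof. exact: (proj1 (proj2 HK)). Qed.
Let add0 : left_id (cm_zero K) (@cm_add K).
Proof. exact: (proj1 (proj2 (proj2 HK))). Qed.
Let addr0 : right_id (cm_zero K) (@cm_add K).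
Proof. by move=> a; rewrite addC add0. Qed.
Let addACA a b c d :
  @cm_add K (cm_add a b) (cm_add c d) = cm_add (cm_add a c) (cm_add b d).
Proof. by rewrite -!addA; congr cm_add; rewrite !addA (addC b). Qed.

Section Sums.
Variable T : Type.
Implicit Types (f g : T -> K) (l : list T).

Lemma lsum_ext f g l : (forall x, In x l -> f x = g x) -> lsum f l = lsum g l.
Proof.
elim: l => //= x l IH fg; rewrite fg; last by left.
by rewrite IH // => y ly; apply: fg; right.
Qed.

Lemma lsum_perm f l l' : Permutation l l' -> lsum f l = lsum f l'.
Proof.
elim=> //= [x l1 l2 _ -> //|x y l1|l1 l2 l3 _ -> _ -> //].
by rewrite !addA (addC (f y)).
Qed.

Lemma lsum_map S (phi : S -> T) f (l : list S) :
  lsum f (List.map phi l) = lsum (fun i => f (phi i)) l.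
Proof. by elim: l => //= i l ->. Qed.

Lemma lsum_add f g l :
  lsum (fun x => cm_add (f x) (g x)) l = cm_add (lsum f l) (lsum g l).
Proof. by elim: l => /= [|x l ->]; [rewrite add0|rewrite addACA]. Qed.

Lemma lsum_zero f l : (forall x, In x l -> f x = cm_zero K) ->
  lsum f l = cm_zero K.
Proof.
elim: l => //= x l IH f0; rewrite f0; last by left.
by rewrite add0 IH // => y ly; apply: f0; right.
Qed.

Lemma lsum_eq0 f l x : lsum f l = cm_zero K -> In x l -> f x = cm_zero K.
Proof.
have pos := proj1 (proj2 (proj2 (proj2 HK))).
by elim: l => //= y l IH /pos [fy0 /IH IHx] [<-|].
Qed.

Let support f l :=
  List.filter (fun x => ~~ excluded_middle_informative (f x = cm_zero K)) l.

Let lsum_support f l : lsum f (support f l) = lsum f l.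
Proof.
elim: l => //= x l; case: excluded_middle_informative => /= [-> ->|_ -> //].
by rewrite add0.
Qed.

Let in_support f l x : In x (support f l) <-> In x l /\ f x <> cm_zero K.
Proof.
by rewrite /support List.filter_In; case: excluded_middle_informative; split=> -[].
Qed.

(** The list chosen by [epsilon] in [finsum] is unknown, but once the zero terms are filtered out it
    is a permutation of the filtered [l], because both are duplicate-free lists of the same
    support. *)
Lemma finsumE f l : NoDup l -> (forall x, f x <> cm_zero K -> In x l) ->
  finsum f = lsum f l.
Proof.
move=> ul fl; rewrite /finsum.
have [ul' fl'] := epsilon_spec (inhabits nil)
  (fun l : list T => NoDup l /\ forall x, f x <> cm_zero K -> In x l)
  (ex_intro _ l (conj ul fl)).
set l' := epsilon _ _ in ul' fl' *.
rewrite -(lsum_support f l') -(lsum_support f l); apply: lsum_perm.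
apply: Permutation.NoDup_Permutation; try exact: List.NoDup_filter.
by move=> x; rewrite !in_support; split=> -[_ fx]; split; auto.
Qed.

Lemma finsum_ext f g : (forall x, f x = g x) -> finsum f = finsum g.
Proof. by move=> fg; have -> : f = g by apply: functional_extensionality. Qed.

Definition fin_supp f := exists l, forall x, f x <> cm_zero K -> In x l.

Lemma finsum_add f g : fin_supp f -> fin_supp g ->
  finsum (fun x => cm_add (f x) (g x)) = cm_add (finsum f) (finsum g).
Proof.
move=> [lf Hf] [lg Hg].
have [l [ul Hl]] : exists l, NoDup l /\
    forall x, f x <> cm_zero K \/ g x <> cm_zero K -> In x l.
  apply: nodup_cover; exists (lf ++ lg)%list => x fg.
  by apply: List.in_or_app; case: fg; [left; apply: Hf|right; apply: Hg].
rewrite !(@finsumE _ l) ?lsum_add // => x ne; apply: Hl; auto.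
case: (excluded_middle_informative (f x = cm_zero K)) => [fx|]; last by left.
by right=> gx; apply: ne; rewrite fx gx add0.
Qed.

Lemma finsum_guard (a : T) (k : K) : finsum (fun x => guard (a = x) k) = k.
Proof.
rewrite (@finsumE _ [:: a]) /= ?guardT ?addr0 //.
  by constructor=> //; constructor.
by move=> x; case: (excluded_middle_informative (a = x)) => [|/guardF->]; auto.
Qed.

Lemma finsum_eq0 f : fin_supp f -> finsum f = cm_zero K ->
  forall x, f x = cm_zero K.
Proof.
move=> /nodup_cover [l [ul Hl]]; rewrite (finsumE ul Hl) => f0 x.
case: (excluded_middle_informative (f x = cm_zero K)) => // fx.
exact: lsum_eq0 f0 (Hl x fx).
Qed.

End Sums.

Lemma fin_supp_lsum S T (phi : S -> T) (w : S -> K) (l : list S) :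
  fin_supp (fun x => lsum (fun i => guard (phi i = x) (w i)) l).
Proof.
exists (List.map phi l) => x ne; apply: NNPP => nin; apply: ne.
apply: lsum_zero => i li; apply: guardF => E; apply: nin.
by rewrite -E; apply: List.in_map.
Qed.

(** Summation over the fibres of [phi]: each index [i] contributes its weight at the single point
    [phi i]. *)
Lemma finsum_lsum S T (phi : S -> T) (w : S -> K) (l : list S) :
  finsum (fun x => lsum (fun i => guard (phi i = x) (w i)) l) = lsum w l.
Proof.
elim: l => [|i l IH] /=.
  by rewrite (@finsumE _ _ [::]) //; constructor.
rewrite finsum_add ?finsum_guard ?IH //; last exact: fin_supp_lsum.
by exists [:: phi i] => x ne; left; apply: NNPP => /guardF.
Qed.

Lemma nsmulD a b (k : K) : nsmul (a + b) k = cm_add (nsmul a k) (nsmul b k).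
Proof. by elim: a => [|a IH] /=; rewrite ?add0 // IH addA. Qed.

Lemma nsmulM a b (k : K) : nsmul (a * b) k = nsmul a (nsmul b k).
Proof. by elim: a => //= a IH; rewrite mulSn nsmulD IH. Qed.

Lemma pcmonoid_neq0 : exists k : K, k <> cm_zero K.
Proof.
have [a [b ab]] := proj2 (proj2 (proj2 (proj2 HK))).
case: (excluded_middle_informative (a = cm_zero K)) => [a0|]; last by exists a.
by exists b => b0; apply: ab; rewrite a0 b0.
Qed.

End FiniteSums.

Lemma lsum_hom (Ks K : cmon) (h : Ks -> K) (T : Type) (f : T -> Ks) l :
  is_hom h -> h (lsum f l) = lsum (fun x => h (f x)) l.
Proof. by move=> [h0 hD]; elim: l => //= x l <-. Qed.

Lemma finsum_hom (Ks K : cmon) (h : Ks -> K) (T : Type) (f : T -> Ks) :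
  is_pcmonoid Ks -> is_pcmonoid K -> is_hom h -> fin_supp f ->
  h (finsum f) = finsum (fun x => h (f x)).
Proof.
move=> HKs HK hh /nodup_cover [l [ul Hl]].
rewrite (finsumE HKs ul Hl) lsum_hom // (finsumE HK ul) // => x hx.
by apply: Hl => fx; apply: hx; rewrite fx (proj1 hh).
Qed.

(** * Relations given by weighted lists, and their marginals *)

Section Pushforward.
Variables (V : finType) (D : V -> Type) (K : cmon) (HK : is_pcmonoid K).
Variables (S : Type) (w : S -> K) (l : list S).

(** The tuples [phi i] may repeat. This freedom keeps the form stable under marginals, which only
    compose [phi] with a restriction ([marg_push]). *)
Definition push (X : {set V}) (phi : S -> atuple D X) : krel D K X :=
  KRel (fin_supp_lsum HK phi w l).

Lemma marg_push (X Y : {set V}) (H : Y \subset X) (phi : S -> atuple D X) t :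
  marg H (push phi) t = push (fun i => restr H (phi i)) t.
Proof.
rewrite /marg /= -[RHS](finsum_lsum HK phi); apply: finsum_ext => r.
rewrite -[LHS]/(guard _ _).
case: (excluded_middle_informative (restr H r = t)) => rt.
  rewrite guardT //; apply: lsum_ext => // i _; rewrite guard_and.
  by apply: guard_iff; split=> [E|[]//]; rewrite E.
rewrite guardF // lsum_zero // => i _; rewrite guard_and.
by apply: guardF => -[->].
Qed.

End Pushforward.

Lemma fin_supp_marg (V : finType) (D : V -> Type) (K : cmon) (X Y : {set V})
    (H : Y \subset X) (R : krel D K X) (t : atuple D Y) :
  fin_supp (fun r : atuple D X => guard (restr H r = t) (R r)).
Proof.
have [l Hl] := krel_fin R; exists l => r ne; apply: Hl => Rr.
by apply: ne; rewrite Rr guard0.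
Qed.

(** By positivity a vanishing sum has only vanishing terms, so the support of a marginal contains
    the restriction of every supported tuple. *)
Lemma marg_eq0 (V : finType) (D : V -> Type) (K : cmon) (X Y : {set V})
    (H : Y \subset X) (R : krel D K X) (r : atuple D X) :
  is_pcmonoid K -> marg H R (restr H r) = cm_zero K -> R r = cm_zero K.
Proof.
move=> HK E; have := finsum_eq0 HK (fin_supp_marg H R (restr H r)) E r.
by rewrite guardT.
Qed.

(** * Finite multisets as lists *)

Notation nat_mon := (@CMon nat 0 Nat.add).

(** Phrased as an [lsum] over [nat_mon], so that the lemmas on finite sums and pushforwards apply to
    multiplicities. *)
Definition cnt (T : Type) (l : list T) (x : T) : nat :=
  @lsum nat_mon _ (fun y => guard (y = x) (1 : nat_mon)) l.

Lemma cnt_count_occ (T : Type) (l : list T) (x : T) :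
  cnt l x = List.count_occ (@ceq_dec T) l x.
Proof.
rewrite /cnt; elim: l => //= y l ->; case: (ceq_dec y x) => yx.
  by rewrite guardT.
by rewrite guardF.
Qed.

Lemma cnt_perm (T : Type) (l l' : list T) :
  (forall x, cnt l x = cnt l' x) -> Permutation l l'.
Proof.
move=> E; apply/(Permutation.Permutation_count_occ (@ceq_dec T)) => x.
by rewrite -!cnt_count_occ.
Qed.

Lemma fin_nat_cnt (T : Type) (f : T -> nat) :
  fin_nat f -> exists l, forall x, f x = cnt l x.
Proof.
move=> /nodup_cover [l [ul Hl]].
(* Each point of the support is repeated as often as [f] prescribes; as [l] has no duplicates, the
   blocks do not add up. *)
pose blocks l0 := List.flat_map (fun x => List.repeat x (f x)) l0.
have cntl x l0 : NoDup l0 -> List.count_occ (@ceq_dec T) (blocks l0) x =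
    if excluded_middle_informative (In x l0) then f x else 0.
  elim: l0 => [_|y l0 IH] /=; first by case: excluded_middle_informative.
  move=> u; have yl0 := List.NoDup_cons_iff y l0.
  case/yl0: u => nyl0 u0; rewrite List.count_occ_app IH //.
  case: (ceq_dec y x) => [yx|ne].
    subst y; rewrite List.count_occ_repeat_eq //.
    case: excluded_middle_informative => [//|?].
    case: excluded_middle_informative => [?|n]; first by exact: addn0.
    by case: n; left.
  rewrite List.count_occ_repeat_neq //; last by move=> E; apply: ne.
  case: excluded_middle_informative => i; case: excluded_middle_informative => j //.
    by case: j; right.
  by case: j.
exists (blocks l) => x; rewrite cnt_count_occ cntl //.
case: excluded_middle_informative => // nl /=.
by apply: NNPP => fx; apply: nl; apply: Hl.
Qed.

(** * The free monoid on the nonzero elements and its cover *)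

Section FreeCover.
Variables (K : cmon) (HK : is_pcmonoid K).

Lemma free_eq (f g : free_mon K) :
  (forall x, proj1_sig f x = proj1_sig g x) -> f = g.
Proof.
case: f g => f Hf [g Hg] /= /functional_extensionality fg; subst g.
by congr exist; apply: proof_irrelevance.
Qed.

Lemma free_pcmonoid : is_pcmonoid (free_mon K).
Proof.
split; first by move=> f g h; apply: free_eq => x /=; apply: addnA.
split; first by move=> f g; apply: free_eq => x /=; apply: addnC.
split; first by move=> f; apply: free_eq.
split.
  move=> f g /(f_equal (@proj1_sig _ _)) /= fg0.
  have E x : proj1_sig f x = 0 /\ proj1_sig g x = 0.
    move: (f_equal (fun u => u x) fg0) => /=.
    by case: (proj1_sig f x) (proj1_sig g x) => [|?] [|?].
  by split; apply: free_eq => x; case: (E x).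
have [k k0] := pcmonoid_neq0 HK.
have F : fin_nat (cnt [:: exist _ k k0 : Kplus K]).
  exists [:: exist _ k k0] => x; rewrite cnt_count_occ /=.
  by case: ceq_dec; auto.
exists (cm_zero (free_mon K)), (exist _ _ F).
move/(f_equal (fun f => proj1_sig f (exist _ k k0))) => /=.
by rewrite cnt_count_occ /=; case: ceq_dec.
Qed.

Lemma nsmul_is_hom (k : K) : is_hom (fun n : nat_mon => nsmul n k).
Proof. by split=> // a b; apply: nsmulD. Qed.

(** Computes the homomorphism on any presentation of [g] as a sum of generators, repetitions
    allowed: [nsmul] is additive in its count, so the sum over generators regroups along the fibres
    of [phi]. *)
Lemma free_hom_lsum (S : Type) (phi : S -> Kplus K) (w : S -> nat) l
    (g : free_mon K) :
  (forall x, proj1_sig g x =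
     @lsum nat_mon _ (fun p => guard (phi p = x) (w p : nat_mon)) l) ->
  free_hom g = lsum (fun p => nsmul (w p) (proj1_sig (phi p))) l.
Proof.
move=> gE; rewrite -(finsum_lsum HK phi); apply: finsum_ext => x.
have hom := nsmul_is_hom (proj1_sig x).
rewrite gE -[LHS]/((fun n : nat_mon => nsmul n (proj1_sig x)) _) lsum_hom //.
apply: lsum_ext => // p _; rewrite (guard_hom _ _ hom).
case: (excluded_middle_informative (phi p = x)) => [->|ne] //.
by rewrite !guardF.
Qed.

Lemma free_hom_is_hom : is_hom (@free_hom K).
Proof.
have FS (f : free_mon K) :
    fin_supp (fun x : Kplus K => nsmul (proj1_sig f x) (proj1_sig x)).
  have [l Hl] := proj2_sig f; exists l => x ne; apply: Hl => fx.
  by apply: ne; rewrite fx.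
split=> [|f g]; last first.
  rewrite /free_hom -finsum_add //; apply: finsum_ext => x; exact: nsmulD.
by rewrite /free_hom (@finsumE _ HK _ _ [::]) //; constructor.
Qed.

Lemma free_cover : is_cover (@free_hom K).
Proof.
split; first exact: free_pcmonoid.
split; first exact: free_hom_is_hom.
move=> k; case: (excluded_middle_informative (k = cm_zero K)) => [->|k0].
  exists (cm_zero (free_mon K)); exact: (proj1 free_hom_is_hom).
pose x0 : Kplus K := exist _ k k0.
have F : fin_nat (cnt [:: x0]).
  by exists [:: x0] => x; rewrite cnt_count_occ /=; case: ceq_dec; auto.
exists (exist _ _ F); rewrite (@free_hom_lsum _ id (fun=> 1) [:: x0]) //=.
have [_ [addC [add0 _]]] := HK.
by rewrite addC add0 addC add0.
Qed.

End FreeCover.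

(** * Partial tuples and entrywise gluing *)

Section PartialTuples.
Variables (V : finType) (D : V -> Type).

(* Tuples over every attribute set embed in this single type, [None] marking the
   attributes outside the set; gluing then needs no dependent casts. *)
Definition ptuple := forall v : V, option (D v).

Definition enc (X : {set V}) (t : atuple D X) : ptuple :=
  fun v => match @idP (v \in X) with
           | ReflectT h => Some (t v h)
           | ReflectF _ => None
           end.

Definition cut (X : {set V}) (s : ptuple) : ptuple :=
  fun v => if v \in X then s v else None.

Lemma encT (X : {set V}) (t : atuple D X) v (h : v \in X) :
  enc t v = Some (t v h).
Proof.
by rewrite /enc; case: {-}_ / idP => // h'; rewrite (bool_irrelevance h' h).
Qed.

Lemma encF (X : {set V}) (t : atuple D X) v : v \notin X -> enc t v = None.
Proof. by rewrite /enc; case: {-}_ / idP => // h' /negP. Qed.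

Lemma enc_inj (X : {set V}) (t t' : atuple D X) : enc t = enc t' -> t = t'.
Proof.
move=> E; apply: functional_extensionality_dep => v.
apply: functional_extensionality_dep => h.
have := f_equal (fun s : ptuple => s v) E => /=.
by rewrite !(encT _ h) => -[].
Qed.

Lemma cut_enc (X Y : {set V}) (H : Y \subset X) (t : atuple D X) :
  cut Y (enc t) = enc (restr H t).
Proof.
apply: functional_extensionality_dep => v; rewrite /cut.
case: (boolP (v \in Y)) => vY; last by rewrite encF.
by rewrite (encT _ vY) (encT _ (subsetP H v vY)).
Qed.

Lemma cut_cut (X Y : {set V}) (s : ptuple) :
  Y \subset X -> cut Y (cut X s) = cut Y s.
Proof.
move=> H; apply: functional_extensionality_dep => v; rewrite /cut.
by case: (boolP (v \in Y)) => // /(subsetP H) ->.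
Qed.

Lemma cut_enc_id (X : {set V}) (t : atuple D X) : cut X (enc t) = enc t.
Proof.
apply: functional_extensionality_dep => v; rewrite /cut.
by case: (boolP (v \in X)) => // nX; rewrite encF.
Qed.

Lemma enc_surj (X : {set V}) (s : ptuple) :
  (forall v, v \in X -> s v <> None) -> exists t : atuple D X, enc t = cut X s.
Proof.
move=> sX.
pose t : atuple D X := fun v h =>
  match s v as o return o <> None -> D v with
  | Some d => fun=> d
  | None => fun ne => match ne erefl with end
  end (sX v h).
exists t; apply: functional_extensionality_dep => v; rewrite /cut.
case: (boolP (v \in X)) => vX; last by rewrite encF.
rewrite (encT _ vX) /t; move: (sX v vX); case: (s v) => [d //|] ne.
by case: ne.
Qed.

Section Weighted.
Variable A : Type.
Implicit Types (L N : list (A * ptuple)).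

Definition encs (X : {set V}) (M : list (A * atuple D X)) : list (A * ptuple) :=
  List.map (fun p => (p.1, enc p.2)) M.

Definition cuts (X : {set V}) L : list (A * ptuple) :=
  List.map (fun p => (p.1, cut X p.2)) L.

Lemma cuts_encs (X Y : {set V}) (H : Y \subset X) (M : list (A * atuple D X)) :
  cuts Y (encs M) = encs (List.map (fun p => (p.1, restr H p.2)) M).
Proof. by elim: M => //= p M ->; rewrite (cut_enc H). Qed.

Lemma cuts_encs_id (X : {set V}) (M : list (A * atuple D X)) :
  cuts X (encs M) = encs M.
Proof. by elim: M => //= p M ->; rewrite cut_enc_id. Qed.

Lemma cuts_cuts (X Y : {set V}) L : Y \subset X -> cuts Y (cuts X L) = cuts Y L.
Proof. by move=> H; elim: L => //= p L ->; rewrite cut_cut. Qed.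

Lemma encs_inj (X : {set V}) (M M' : list (A * atuple D X)) :
  encs M = encs M' -> M = M'.
Proof.
by elim: M M' => [|[a t] M IH] [|[a' t'] M'] //= [-> /enc_inj -> /IH ->].
Qed.

Lemma encs_perm (X : {set V}) (M M' : list (A * atuple D X)) :
  Permutation (encs M) (encs M') -> Permutation M M'.
Proof. by case/Permutation.Permutation_map_inv => M3 [/encs_inj ->]; symmetry. Qed.

(** Each tuple of [L] is overwritten on [Xb] by its partner in [N]. The partners agree on [Xa], so a
    set [Z] that meets [Xb] only inside [Xa] does not notice the change. *)
Lemma glue_eq (Xa Xb : {set V}) L N : cuts Xa L = cuts Xa N ->
  exists L', (forall Z : {set V}, Z :&: Xb \subset Xa -> cuts Z L' = cuts Z L) /\
             cuts Xb L' = cuts Xb N.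
Proof.
elim: L N => [|[k s] L IH] [|[k' s'] N] //=; first by exists [::].
case=> <- ss' /IH [L' [L'Z L'b]].
exists ((k, fun v => if v \in Xb then s' v else s v) :: L'); split.
  move=> Z ZX /=; rewrite L'Z //; congr ((_, _) :: _).
  apply: functional_extensionality_dep => v; rewrite /cut.
  case vZ: (v \in Z) => //; case vb: (v \in Xb) => //.
  have va : v \in Xa by apply: (subsetP ZX); rewrite inE vZ.
  by have := f_equal (fun s : ptuple => s v) ss'; rewrite /cut va.
rewrite /= L'b; congr ((_, _) :: _).
by apply: functional_extensionality_dep => v; rewrite /cut; case: (v \in Xb).
Qed.

(** A reordering of the cut list lifts to a reordering of [N] itself, which reduces the claim to the
    entrywise case. *)
Lemma glue (Xa Xb : {set V}) L N : Permutation (cuts Xa L) (cuts Xa N) ->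
  exists L', (forall Z : {set V}, Z :&: Xb \subset Xa -> cuts Z L' = cuts Z L) /\
             Permutation (cuts Xb L') (cuts Xb N).
Proof.
case/Permutation.Permutation_map_inv => N' [/glue_eq LN' NN'].
have [L' [L'Z L'b]] := LN' Xb; exists L'; split=> //; rewrite L'b.
by apply: Permutation.Permutation_map; symmetry.
Qed.

End Weighted.
End PartialTuples.

(** * Gluing along a join tree *)

(** If [v] were in [X l] and [X b] but not in [X a], then [b] would reach [l] through hyperedges
    containing [v], hence avoiding [a], and [l] would reach [a] inside [S], hence avoiding [b].
    Neither path uses the tree edge between [a] and [b], which is a bridge. *)
Lemma join_tree_separation (V : finType) m (X : 'I_m -> {set V}) (E : rel 'I_m)
    (S : {set 'I_m}) (a b l : 'I_m) :
  is_tree E ->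
  (forall (v : V) i j, v \in X i -> v \in X j ->
     connect (fun x y => E x y && (v \in X y)) i j) ->
  connect (fun x y => [&& E x y, x \in S & y \in S]) l a ->
  E a b -> b \notin S -> X l :&: X b \subset X a.
Proof.
move=> [symE [_ [_ bridge]]] RI la Eab bS.
apply/subsetP => v; rewrite inE => /andP [vl vb]; apply/negPn/negP => va.
rewrite symE in Eab; case/negP: (bridge _ _ Eab).
set E' := (X in connect X).
have E'v x y : v \in X x -> v \in X y -> E x y -> E' x y.
  move=> vx vy Exy; rewrite /E' Exy /=; apply/norP; split; apply/nandP.
    by right; apply: contraNneq va => <-.
  by left; apply: contraNneq va => <-.
apply: (@connect_trans _ _ l).
  case/connectP: (RI v b l vb vl) => p pb ->.
  elim: p (b) vb pb => [|y p IH] x vx //= /andP [/andP [Exy vy] py].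
  by apply: connect_trans (connect1 (E'v _ _ vx vy Exy)) (IH _ vy py).
apply: connect_sub la => x y /and3P [Exy xS yS]; apply: connect1.
rewrite /E' Exy /=; apply/norP; split; apply/nandP; [left|right];
  by apply: contraNneq bS => <-.
Qed.

Section GluingAlongTree.
Variables (V : finType) (D : V -> Type) (A : Type) (m : nat).
Variables (X : 'I_m -> {set V}) (M : forall i, list (A * atuple D (X i))).

(** A connected set [S] of hyperedges with a common list grows by one tree neighbour [b] at a time.
    Separation says that [b] meets each member of [S] only inside its neighbour [a], so gluing over
    [X a] preserves what was achieved. *)
Lemma glue_along_tree (E : rel 'I_m) (r : 'I_m) :
  is_tree E ->
  (forall (v : V) i j, v \in X i -> v \in X j ->
     connect (fun x y => E x y && (v \in X y)) i j) ->
  (forall i j, exists N : list (A * ptuple D),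
     Permutation (cuts (X i) N) (encs (M i)) /\
     Permutation (cuts (X j) N) (encs (M j))) ->
  exists L : list (A * ptuple D),
    forall i, Permutation (cuts (X i) L) (encs (M i)).
Proof.
move=> TE RI PW; have [symE [_ [conE _]]] := TE.
pose ES (S : {set 'I_m}) : rel 'I_m := fun x y => [&& E x y, x \in S & y \in S].
pose good (S : {set 'I_m}) := exists L : list (A * ptuple D),
  forall i, i \in S -> Permutation (cuts (X i) L) (encs (M i)).
suff grow n (S : {set 'I_m}) : #|~: S| = n -> r \in S ->
    (forall i, i \in S -> connect (ES S) i r) -> good S -> good setT.
  case: (grow _ [set r] erefl) => [|i|| L HL]; first by rewrite inE.
  - by rewrite inE => /eqP ->.
  - by exists (encs (M r)) => i; rewrite inE => /eqP ->; rewrite cuts_encs_id.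
  - by exists L => i; apply: HL; rewrite inE.
elim/ltn_ind: n S => n IH S Sn rS conS goodS.
case: (boolP (setT \subset S)) => [|/subsetPn [x _ xS]].
  by rewrite subTset => /eqP <-.
(* The first edge by which a path from [r] to a missing node leaves [S]. *)
have [a [b [aS bS Eab]]] : exists a b, [/\ a \in S, b \notin S & E a b].
  case/connectP: (conE r x) => p pr xE; rewrite xE in xS.
  elim: p (r) rS pr {xE} xS => [y yS _|y p IHp z zS /=]; first by rewrite yS.
  case/andP=> Ezy py; case: (boolP (y \in S)) => yS; first exact: IHp.
  by move=> _; exists z, y.
have [L HL] := goodS.
have symES S' : connect_sym (ES S').
  by apply: sym_connect_sym => i j; rewrite /ES symE; congr (_ && _); apply: andbC.
have [N [Na Nb]] := PW a b.
have LN : Permutation (cuts (X a) L) (cuts (X a) N).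
  by apply: Permutation.Permutation_trans (HL a aS) _; symmetry.
have [L' [L'Z L'b]] := glue (X b) LN.
have SS' i : i \in S -> connect (ES (b |: S)) i r.
  move/conS; apply: connect_sub => y z /and3P [Eyz yS zS]; apply: connect1.
  by rewrite /ES Eyz !inE yS zS !orbT.
apply: (IH #|~: (b |: S)| _ (b |: S)) => //.
- rewrite -Sn; apply/proper_card/properP; split; first by rewrite setCS subsetUr.
  by exists b; rewrite !inE ?eqxx.
- by rewrite inE rS orbT.
- move=> i; rewrite 2!inE => /orP [/eqP ->|]; last exact: SS'.
  apply: connect_trans (SS' a aS); apply: connect1.
  by rewrite /ES symE Eab !inE eqxx aS orbT.
- exists L' => i; rewrite 2!inE => /orP [/eqP ->|iS].
    exact: Permutation.Permutation_trans L'b Nb.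
  rewrite L'Z; first exact: HL.
  apply: join_tree_separation TE RI _ Eab bS.
  by apply: connect_trans (conS i iS) _; rewrite symES; apply: conS.
Qed.

End GluingAlongTree.

(** * Relations over the free monoid as multisets *)

Section FreeRelations.
Variables (V : finType) (D : V -> Type) (K : cmon) (HK : is_pcmonoid K).

Definition represents (X : {set V}) (M : list (Kplus K * atuple D X))
    (R : atuple D X -> free_mon K) :=
  forall x t, proj1_sig (R t) x = cnt M (x, t).

Lemma represents_ex (X : {set V}) (R : krel D (free_mon K) X) :
  exists M, represents M R.
Proof.
(* Finitely many tuples have a nonzero value, and each value involves finitely many generators, so
   the pairs with nonzero coefficient are finite in number. *)
have F : fin_nat (fun p : Kplus K * atuple D X => proj1_sig (R p.2) p.1).
  have [l Hl] := krel_fin R.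
  have [l' Hl'] : exists l', forall t x, In t l -> proj1_sig (R t) x <> 0 ->
      In (x, t) l'.
    elim: l {Hl} => [|t l [l' IH]]; first by exists [::].
    have [lt Ht] := proj2_sig (R t).
    exists (List.map (fun x => (x, t)) lt ++ l')%list => t' x.
    case=> [<-|tl] ne; apply: List.in_or_app; last by right; apply: IH.
    by left; apply: (List.in_map (fun x => (x, t))); apply: Ht.
  exists l' => -[x t] /= ne; apply: Hl' => //; apply: Hl => Rt.
  by apply: ne; rewrite Rt.
by have [M HM] := fin_nat_cnt F; exists M => x t; rewrite -HM.
Qed.

(** Reading off the coefficient of a fixed generator [x] is a homomorphism to the naturals, so it
    commutes with the marginal; what remains is the marginal of a pushforward over [nat_mon]. *)
Lemma represents_marg (X Y : {set V}) (H : Y \subset X)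
    (W : krel D (free_mon K) X) M :
  represents M W ->
  represents (List.map (fun p => (p.1, restr H p.2)) M) (marg H W).
Proof.
move=> MW x t.
pose w (p : Kplus K * atuple D X) : nat_mon := guard (p.1 = x) (1 : nat_mon).
have hom : is_hom (fun f : free_mon K => proj1_sig f x : nat_mon) by [].
rewrite /marg [LHS](finsum_hom (free_pcmonoid HK) nat_pcmonoid hom);
  last exact: fin_supp_marg.
transitivity (marg H (push nat_pcmonoid w M snd) t).
  rewrite /marg; apply: (@finsum_ext nat_mon) => r.
  rewrite -[RHS]/(guard _ _) [LHS](guard_hom _ _ hom) MW.
  congr guard; apply: (@lsum_ext nat_mon) => -[y s] _ /=.
  rewrite guard_and; apply: (@guard_iff nat_mon).
  by split=> /= -[-> ->].
rewrite marg_push /cnt (@lsum_map nat_mon); apply: (@lsum_ext nat_mon) => -[y s] _ /=.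
rewrite guard_and; apply: (@guard_iff nat_mon).
by split=> /= -[-> ->].
Qed.

Lemma represents_perm (X : {set V}) (R R' : atuple D X -> free_mon K) M M' :
  represents M R -> represents M' R' -> (forall t, R t = R' t) ->
  Permutation M M'.
Proof. by move=> MR MR' RR'; apply: cnt_perm => -[x t]; rewrite -MR RR' MR'. Qed.

Lemma free_hom_represents (X : {set V}) (R : atuple D X -> free_mon K) M t :
  represents M R ->
  free_hom (R t) = lsum (fun p => guard (p.2 = t) (proj1_sig p.1)) M.
Proof.
move=> MR.
pose w (p : Kplus K * atuple D X) : nat := guard (p.2 = t) (1 : nat_mon).
rewrite (@free_hom_lsum _ HK _ fst w M); last first.
  move=> x; rewrite MR; apply: (@lsum_ext nat_mon) => -[y s] _ /=.
  by rewrite guard_and; apply: (@guard_iff nat_mon); split=> /= -[-> ->].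
apply: lsum_ext => p _.
rewrite (guard_hom _ _ (nsmul_is_hom HK (proj1_sig p.1))) /=.
by have [_ [addC [add0 _]]] := HK; rewrite addC add0.
Qed.

End FreeRelations.

Lemma acyclic_LTG_free (K : cmon) (V : finType) m (X : 'I_m -> {set V}) :
  is_pcmonoid K -> acyclic X -> LTG_up_to (@free_hom K) X.
Proof.
move=> HK [E [TE RI]] D R [Rs [RsR PW]].
have [M HM] : exists M : forall i, list (Kplus K * atuple D (X i)),
    forall i, represents (M i) (Rs i).
  exists (fun i => proj1_sig (constructive_indefinite_description _
                                (represents_ex (Rs i)))) => i.
  by case: constructive_indefinite_description.
case: m => [|m] in X E TE RI R Rs RsR PW M HM *.
  (* Without hyperedges there is no marginal to check, and the zero relation serves. *)
  by exists (push HK (fun=> cm_zero K) [::] id) => -[].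
have [L HL] : exists L, forall i, Permutation (cuts (X i) L) (encs (M i)).
  apply: (glue_along_tree ord0 TE RI) => i j.
  have [W [Wi Wj]] := PW i j; have [N HN] := represents_ex W.
  exists (encs N); rewrite (cuts_encs (subsetUl _ _)) (cuts_encs (subsetUr _ _)).
  split; apply: Permutation.Permutation_map.
    exact: represents_perm (represents_marg HK _ HN) (HM i) Wi.
  exact: represents_perm (represents_marg HK _ HN) (HM j) Wj.
pose U := \bigcup_(j < m.+1) X j.
have [N HN] : exists N : list (Kplus K * atuple D U), encs N = cuts U L.
  (* Cut to [X i], each entry of [L] occurs among encodings of total tuples over [X i], so it is
     defined on all of [U] and comes from a genuine tuple. *)
  have LU p : In p L -> forall v, v \in U -> p.2 v <> None.
    move=> pL v /bigcupP [i _ vi].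
    have := List.in_map (fun p => (p.1, cut (X i) p.2)) _ _ pL.
    move/(Permutation.Permutation_in _ (HL i)).
    case/List.in_map_iff => -[k t] [[_ tE] _].
    have := f_equal (fun s : ptuple D => s v) tE.
    by rewrite /cut vi (encT _ vi) => <-.
  elim: L {HL} LU => [|[k s] L IH] LU; first by exists [::].
  have [p pL|N NL] := IH; first by apply: LU; right.
  have [t tE] := @enc_surj V D U s (LU (k, s) (or_introl erefl)).
  by exists ((k, t) :: N); rewrite /= tE NL.
(* The image under the free cover: the generator attached to each entry becomes its weight in
   [K]. *)
exists (push HK (fun p => proj1_sig p.1) N snd) => i t.
rewrite marg_push -RsR (free_hom_represents HK _ (HM i)) /=.
rewrite -(lsum_map (fun p => (p.1, restr (sub_bigcup X i) p.2))
  (fun p => guard (p.2 = t) (proj1_sig p.1))).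
apply: (lsum_perm HK); apply: encs_perm; rewrite -cuts_encs HN cuts_cuts //.
exact: sub_bigcup.
Qed.

(** * Graham reduction and construction of join trees *)

Lemma connect_homo (T T' : finType) (e : rel T) (e' : rel T') (f : T -> T') :
  (forall x y, e x y -> connect e' (f x) (f y)) ->
  forall x y, connect e x y -> connect e' (f x) (f y).
Proof.
move=> ee' x y /connectP [p px ->].
elim: p x px => [|z p IH] x //= /andP [/ee' xz pz].
exact: connect_trans xz (IH _ pz).
Qed.

Lemma mem_In (T : eqType) (x : T) (s : seq T) : x \in s -> In x s.
Proof.
by elim: s => //= y s IH; rewrite inE => /orP [/eqP ->|/IH]; [left|right].
Qed.

Section Reduction.
Variables (V : finType) (m : nat) (X : 'I_m -> {set V}).
Implicit Types (S : {set 'I_m}) (Y : {set V}) (E : rel 'I_m).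

(** The invariant of the reduction. It quantifies over all hyperedges, deleted ones included, so
    that relations on a stuck remainder can later be extended to the whole hypergraph. *)
Definition covers S Y :=
  forall i, exists2 j, j \in S & X i :&: Y \subset X j.

(* Neither rule of the Graham reduction applies to the hypergraph with the edges
   [X i :&: Y], [i \in S]: no vertex lies in exactly one edge and no edge is
   contained in another one. *)
Definition stuck S Y :=
  [/\ 1 < #|S|,
      forall v, v \in Y -> #|[set i in S | v \in X i]| <> 1 &
      forall a b, a \in S -> b \in S -> a != b -> ~~ (X a :&: Y \subset X b)].

Definition del_edge E (i j : 'I_m) : rel 'I_m := fun a b =>
  E a b && ~~ (((a == i) && (b == j)) || ((a == j) && (b == i))).

(** The tree lives on [S] but inside the fixed type of indices, and the running intersection is
    required only for vertices in [Y]; with both sets full this yields [acyclic]. *)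
Definition join_tree S Y E :=
  [/\ (forall i j, E i j = E j i) /\ (forall i, ~~ E i i),
      forall i j, E i j -> i \in S,
      forall i j, i \in S -> j \in S -> connect E i j,
      forall i j, E i j -> ~~ connect (del_edge E i j) i j &
      forall v i j, v \in Y -> i \in S -> j \in S -> v \in X i -> v \in X j ->
        connect (fun a b => E a b && (v \in X b)) i j].

(** Undoes the deletion of a contained hyperedge by hanging [a] as a leaf on [b]. *)
Lemma join_tree_leaf S Y E (a b : 'I_m) :
  a \in S -> b \in S -> a != b -> X a :&: Y \subset X b ->
  join_tree (S :\ a) Y E -> exists E', join_tree S Y E'.
Proof.
move=> aS bS ab Xab [[symE irrE] suppE conE bridge RI].
pose E' : rel 'I_m := fun i j =>
  [|| E i j, (i == a) && (j == b) | (i == b) && (j == a)].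
have EnaL i j : E i j -> i != a by move/suppE; rewrite !inE => /andP [].
have EnaR i j : E i j -> j != a by rewrite symE => /EnaL.
have symE' i j : E' i j = E' j i.
  by rewrite /E' symE; congr (_ || _); rewrite orbC; congr orb; apply: andbC.
have EE' i j : E i j -> E' i j by rewrite /E' => ->.
have E'ab : E' a b by rewrite /E' !eqxx orbT.
have sym_del i j : connect_sym (del_edge E' i j).
  apply: sym_connect_sym => x y; rewrite /del_edge symE'; congr (_ && ~~ _).
  by rewrite orbC; congr orb; apply: andbC.
have inS' i : i \in S -> i != a -> i \in S :\ a by rewrite !inE => -> ->.
(* The only [E']-neighbour of [a] is [b], so no path leaves [a] once that edge is removed. *)
have nab : ~~ connect (del_edge E' a b) a b.
  apply/connectP => -[[|y p] /= pa bE]; first by rewrite bE eqxx in ab.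
  case/andP: pa => /andP [/or3P [Ea|/andP [_ /eqP ->]|/andP [/eqP abE _]] nd] _.
  - by move/EnaL: Ea; rewrite eqxx.
  - by rewrite !eqxx in nd.
  - by rewrite abE eqxx in ab.
exists E'; split.
- split=> // i; rewrite /E' (negPf (irrE i)) /=; apply/norP.
  by split; apply/negP => /andP [/eqP -> /eqP E1]; rewrite E1 eqxx in ab.
- move=> i j /or3P [/suppE|/andP [/eqP -> _]|/andP [/eqP -> _]] //.
  by rewrite inE => /andP [].
- have toB i : i \in S -> connect E' i b.
    move=> iS; have [->|ia] := eqVneq i a; first exact: connect1.
    apply: connect_sub (conE i b (inS' i iS ia) _) => [x y /EE'|].
      exact: connect1.
    by apply: inS' => //; rewrite eq_sym.
  move=> i j /toB ib /toB jb; apply: connect_trans ib _.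
  by rewrite (sym_connect_sym symE').
- move=> i j /or3P [Eij|/andP [/eqP -> /eqP ->] //|/andP [/eqP -> /eqP ->]].
    apply: contra (bridge i j Eij) => ij.
    (* Collapsing [a] onto [b] shrinks the new edge to a point and sends an [E']-path avoiding an
       old edge to an [E]-path avoiding it. *)
    pose f x := if x == a then b else x.
    have -> : i = f i by rewrite /f (negPf (EnaL _ _ Eij)).
    have -> : j = f j by rewrite /f (negPf (EnaR _ _ Eij)).
    rewrite {1}/f (negPf (EnaL _ _ Eij)) {1}/f (negPf (EnaR _ _ Eij)).
    apply: connect_homo ij => x y.
    case/andP=> /or3P [Exy nd|/andP [/eqP -> /eqP ->] _|/andP [/eqP -> /eqP ->] _].
    + rewrite /f (negPf (EnaL _ _ Exy)) (negPf (EnaR _ _ Exy)).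
      by apply: connect1; rewrite /del_edge Exy.
    + by rewrite /f eqxx eq_sym (negPf ab).
    + by rewrite /f eqxx eq_sym (negPf ab).
  apply: contra nab; rewrite sym_del.
  by apply: connect_sub => x y xy; apply: connect1; rewrite /del_edge orbC.
- move=> v i j vY iS jS vi vj.
  have sub x y : connect (fun c d => E c d && (v \in X d)) x y ->
      connect (fun c d => E' c d && (v \in X d)) x y.
    by apply: connect_sub => c d /andP [/EE' cd vd]; apply: connect1; rewrite cd.
  (* A vertex of [Y] in [X a] also lies in [X b], so paths from or to [a] can be routed through
     [b]. *)
  have vb : v \in X a -> v \in X b.
    by move=> va; apply: (subsetP Xab); rewrite inE va.
  have bS' : b \in S :\ a by apply: inS' => //; rewrite eq_sym.
  have [ia|ia] := eqVneq i a; have [ja|ja] := eqVneq j a.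
  + by rewrite ia ja.
  + rewrite ia in vi *; apply: (@connect_trans _ _ b).
      by apply: connect1; rewrite E'ab vb.
    by apply/sub/RI => //; [apply: inS'|apply: vb].
  + rewrite ja in vj *; apply: (@connect_trans _ _ b); last first.
      by apply: connect1; rewrite symE' E'ab.
    by apply/sub/RI => //; [apply: inS'|apply: vb].
  + by apply/sub/RI => //; apply: inS'.
Qed.

Lemma join_tree_ex S Y :
  (forall S' Y', covers S' Y' -> ~ stuck S' Y') ->
  covers S Y -> exists E, join_tree S Y E.
Proof.
move=> nostuck; have [n Sn] := ubnP (#|S| + #|Y|).
elim: n S Y Sn => // n IH S Y Sn cov.
have [S1|S1] := leqP #|S| 1.
  have eqS i j : i \in S -> j \in S -> i = j by move=> iS jS; apply: (card_le1_eqP S1).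
  exists (fun _ _ => false); split=> //.
    by move=> i j iS jS; rewrite (eqS i j iS jS).
  by move=> v i j _ iS jS _ _; rewrite (eqS i j iS jS).
apply: NNPP => noE; apply: (nostuck S Y cov); split=> //.
(* If [v] lies in a single hyperedge [k], a tree for [Y :\ v] already works: the running
   intersection at [v] only compares [k] with itself. *)
- move=> v vY /eqP/cards1P [k Sv]; apply: noE.
  have [||E [E1 E2 E3 E4 RI]] := IH S (Y :\ v).
  + by move: Sn; rewrite (cardsD1 v Y) vY addnCA ltnS; apply.
  + move=> i; have [j jS ij] := cov i; exists j => //.
    by apply: subset_trans ij; rewrite setIS // subD1set.
  exists E; split=> // u i j uY iS jS ui uj.
  have [uv|uv] := eqVneq u v; last by apply: RI => //; rewrite !inE uv.
  have eqk l : l \in S -> u \in X l -> l = k.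
    by move=> lS ul; apply/set1P; rewrite -Sv inE lS -uv.
  by rewrite (eqk i) // (eqk j).
- move=> a b aS bS ab; apply/negP => Xab; apply: noE.
  have [||E] := IH (S :\ a) Y; last exact: join_tree_leaf aS bS ab Xab.
  + by move: Sn; rewrite (cardsD1 a S) aS addSn ltnS; apply.
  + move=> i; have [j jS ij] := cov i.
    (* A hyperedge that was covered by [a] is now covered by [b]. *)
    have [ja|ja] := eqVneq j a; last by exists j; rewrite ?inE ?ja.
    exists b; first by rewrite !inE eq_sym ab.
    apply: subset_trans Xab; rewrite subsetI subsetIr andbT -ja.
    exact: ij.
Qed.

Lemma acyclic_of_not_stuck :
  (forall S Y, covers S Y -> ~ stuck S Y) -> acyclic X.
Proof.
move=> nostuck.
have [|E [[symE irrE] _ conE bridge RI]] := @join_tree_ex setT setT nostuck.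
  by move=> i; exists i; rewrite ?inE // setIT.
exists E; split; last by move=> v i j; apply: RI; rewrite inE.
by do !split=> //; move=> i j; apply: conE; rewrite inE.
Qed.

End Reduction.

(** * Inconsistent linear systems over a finite field on a stuck hypergraph *)

Section LinearEquations.
Import GRing.Theory.
Local Open Scope ring_scope.

Lemma zero_sum_units (p : nat) (I : finType) (A : {set I}) :
  prime p -> (#|A| <= p)%N -> #|A| <> 1%N ->
  exists c : I -> 'F_p, (forall i, i \in A -> c i != 0) /\ \sum_(i in A) c i = 0.
Proof.
move=> pp Ap A1; have [->|[i0 i0A]] := set_0Vmem A.
  by exists (fun=> 1); split=> [i|]; rewrite ?inE ?big_set0.
(* All coefficients are one except at [i0], which balances them; its coefficient is nonzero because
   [#|A|.-1] lies strictly between zero and [p]. *)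
exists (fun i => if i == i0 then - (#|A|.-1)%:R else 1); split.
  move=> i iA; have [_|_] := eqVneq i i0; last exact: oner_neq0.
  rewrite oppr_eq0 -(dvdn_pcharf (pchar_Fp pp)) gtnNdvd //.
    by move: A1; rewrite (cardsD1 i0) i0A; case: #|_|.
  by move: Ap; rewrite (cardsD1 i0) i0A.
rewrite (big_setD1 i0) //= eqxx (eq_bigr (fun=> 1)); last first.
  by move=> i; rewrite !inE => /andP [/negPf ->].
by rewrite sumr_const (cardsD1 i0 A) i0A /= addrC subrr.
Qed.

(** The maps [sh s] are bijections preserving [P] and translating the values of [g], so all fibres
    of [g] within [P] have the same size. *)
Lemma card_fiber_shift (T : finType) (F : finZmodType) (P : pred T) (g : T -> F)
    (sh : F -> T -> T) (y : F) :
  (forall s t, sh (- s) (sh s t) = t) -> (forall s t, P (sh s t) = P t) ->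
  (forall s t, g (sh s t) = g t + s) ->
  #|P| = (#|F| * #|[pred t | P t && (g t == y)]|)%N.
Proof.
move=> shK Psh gsh; rewrite -sum1_card (partition_big g predT) //=.
rewrite -sum_nat_const; apply: eq_big => [s|s _]; first by rewrite inE.
have shKV r t : sh r (sh (- r) t) = t by rewrite -{1}(opprK r) shK.
rewrite -sum1_card (reindex (sh (s - y))) /=; last first.
  by exists (sh (- (s - y))) => t _; [apply: shK|apply: shKV].
apply: eq_bigl => t; rewrite !inE -!topredE /= Psh gsh; congr (_ && _).
by rewrite addrCA -[X in _ == X]addr0 (inj_eq (addrI s)) subr_eq0.
Qed.

Section Tseitin.
Variables (V : finType) (m : nat) (X : 'I_m -> {set V}).
Variables (S : {set 'I_m}) (Y : {set V}).
Hypothesis HS : stuck X S Y.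
Variables (F : finFieldType) (c : 'I_m -> V -> F).
Hypothesis c_unit : forall i v, i \in S -> v \in X i -> v \in Y -> c i v != 0.
Hypothesis c_sum : forall v, v \in Y -> \sum_(i in S | v \in X i) c i v = 0.
Variables (i0 : 'I_m) (f : 'I_m -> 'I_m).
Hypothesis i0S : i0 \in S.
Hypothesis fS : forall i, f i \in S.
Hypothesis fX : forall i, X i :&: Y \subset X (f i).

Local Notation A := {ffun V -> F}.

Definition lhs (i : 'I_m) (t : A) : F := \sum_(v in X i :&: Y) c i v * t v.
Definition sat (i : 'I_m) (t : A) : bool := lhs i t == (i == i0)%:R.

Definition tup (Z : {set V}) (t : A) : atuple (fun _ : V => F) Z := fun v _ => t v.
Arguments tup : clear implicits.

(** Changes the coordinate [u] alone, by the amount that raises the equation of [b] by [s];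
    equations of hyperedges without [u] are untouched. *)
Definition shift (b : 'I_m) (u : V) (s : F) (t : A) : A :=
  [ffun v => t v + (v == u)%:R * (s / c b u)].

Lemma shiftK b u s t : shift b u (- s) (shift b u s t) = t.
Proof. by apply/ffunP => v; rewrite !ffunE mulNr mulrN addrK. Qed.

Lemma lhs_shift_in b u s t : b \in S -> u \in X b -> u \in Y ->
  lhs b (shift b u s t) = lhs b t + s.
Proof.
move=> bS ub uY; have ubY : u \in X b :&: Y by rewrite inE ub.
rewrite /lhs (eq_bigr (fun v => c b v * t v + c b v * ((v == u)%:R * (s / c b u)))).
  rewrite big_split /=; congr (_ + _); rewrite (bigD1 u) //= eqxx mul1r.
  rewrite big1 ?addr0 => [|v /andP [_ /negPf ->]]; last by rewrite mul0r mulr0.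
  by rewrite mulrC divfK // c_unit.
by move=> v _; rewrite ffunE mulrDr.
Qed.

Lemma lhs_shift_out a b u s t : u \notin X a -> lhs a (shift b u s t) = lhs a t.
Proof.
move=> ua; apply: eq_bigr => v; rewrite inE => /andP [va _]; rewrite ffunE.
by case: eqP => [E|_]; [rewrite -E va in ua|rewrite mul0r addr0].
Qed.

Lemma tup_shift (Z : {set V}) b u s t : u \notin Z ->
  tup Z (shift b u s t) = tup Z t.
Proof.
move=> uZ; apply: functional_extensionality_dep => v.
apply: functional_extensionality_dep => vZ; rewrite /tup ffunE.
by case: eqP => [E|_]; [rewrite -E vZ in uZ|rewrite mul0r addr0].
Qed.

Section Weights.
Variables (Ks : cmon) (HKs : is_pcmonoid Ks) (k : Ks).

(* The factor [#|F|] makes up for the second equation, which divides the number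
   of solutions by [#|F|]. *)
Definition weight (a b : 'I_m) (t : A) : Ks :=
  if sat a t && sat b t then (if a == b then k else nsmul #|F| k) else cm_zero Ks.

Definition tseitin (a b : 'I_m) (Z : {set V}) : krel (fun=> F) Ks Z :=
  push HKs (weight a b) (enum A) (tup Z).

Lemma lsum_enum (T : finType) (P : T -> Prop) (Q : pred T) (x : Ks) :
  lsum (fun t => guard (P t) (if Q t then x else cm_zero Ks)) (enum T) =
  nsmul #|[pred t | Q t && excluded_middle_informative (P t)]| x.
Proof.
rewrite cardE enumT /enum_mem size_filter.
have [_ [_ [add0 _]]] := HKs.
elim: (Finite.enum T) => //= t l ->; rewrite inE.
case: (Q t) => /=; last by rewrite guard0 add0.
by rewrite /guard; case: excluded_middle_informative => /= _; rewrite ?add0.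
Qed.

Lemma tseitinE a b Z z : tseitin a b Z z =
  nsmul #|[pred t | (sat a t && sat b t) &&
                    excluded_middle_informative (tup Z t = z)]|
        (if a == b then k else nsmul #|F| k).
Proof. exact: lsum_enum. Qed.

Lemma tseitinC a b Z z : tseitin a b Z z = tseitin b a Z z.
Proof.
rewrite !tseitinE eq_sym; congr nsmul; apply: eq_card => t.
by rewrite !inE (andbC (sat a t)).
Qed.

(** Since [b] is not contained in [a] within [Y], it has a vertex [u] outside [X a], hence outside
    [Z]. Shifting along [u] moves the equation of [b] through all values while fixing the equation
    of [a] and the tuple on [Z]; so the second equation divides the count by [#|F|], which the
    weight restores. *)
Lemma tseitin_diag a b (Z : {set V}) z : a \in S -> b \in S ->
  Z :&: Y \subset X a -> tseitin a b Z z = tseitin a a Z z.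
Proof.
move=> aS bS Za; have [<- //|ab] := eqVneq a b.
have [_ _ /(_ b a bS aS)] := HS; rewrite eq_sym => /(_ ab).
case/subsetPn => u; rewrite inE => /andP [ub uY] ua.
have uZ : u \notin Z.
  by apply: contra ua => uZ; apply: (subsetP Za); rewrite inE uZ.
rewrite !tseitinE eqxx (negPf ab) -nsmulM //; congr nsmul.
pose P t := sat a t && excluded_middle_informative (tup Z t = z).
transitivity (#|F| * #|[pred t | P t && (lhs b t == (b == i0)%:R)]|)%N.
  rewrite mulnC; congr (_ * _)%N; apply: eq_card => t.
  by rewrite !inE /P -!andbA; congr (_ && _); apply: andbC.
rewrite -(@card_fiber_shift _ F P (lhs b) (shift b u)).
- by apply: eq_card => t; rewrite !inE andbb.
- by move=> s t; apply: shiftK.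
- by move=> s t; rewrite /P /sat lhs_shift_out // tup_shift.
- by move=> s t; apply: lhs_shift_in.
Qed.

(** The common solutions of the equations of [f i] and [f j] are the witness; each marginal forgets
    the other equation. *)
Lemma tseitin_pw_consistent :
  pw_consistent (fun i => tseitin (f i) (f i) (X i)).
Proof.
move=> i j; exists (tseitin (f i) (f j) (X i :|: X j)); split=> t.
  by rewrite marg_push; apply: tseitin_diag.
by rewrite marg_push -[LHS]/(tseitin _ _ _ _) tseitinC; apply: tseitin_diag.
Qed.

End Weights.

(** A supported tuple of a global witness would solve every equation of [S], but adding these
    equations gives zero on the left and one on the right. *)
Lemma tseitin_not_gl_consistent (K : cmon) (HK : is_pcmonoid K) (k : K) :
  k <> cm_zero K ->
  ~ gl_consistent (fun i => tseitin HK k (f i) (f i) (X i)).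
Proof.
move=> k0 [W HW]; have [S1 _ anti] := HS.
have f_id i : i \in S -> f i = i.
  move=> iS; apply/eqP; apply: contraTT (fX i) => ne.
  by apply: anti => //; rewrite eq_sym.
(* A single equation is solvable, by shifting the zero assignment along a vertex of [i0]. This makes
   the relation at [i0], and hence [W], nonzero. *)
have [t0 t0sat] : exists t, sat i0 t.
  have [j jS ji] : exists2 j, j \in S & j != i0.
    move: S1; rewrite (cardsD1 i0) i0S add1n ltnS card_gt0 => /set0Pn [j].
    by rewrite !inE => /andP [ji jS]; exists j.
  have := anti i0 j i0S jS; rewrite eq_sym => /(_ ji) /subsetPn [u].
  rewrite inE => /andP [ui uY] _; exists (shift i0 u 1 0).
  rewrite /sat lhs_shift_in // eqxx /lhs big1 ?add0r // => v _.
  by rewrite ffunE mulr0.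
have [r Wr] : exists r, W r <> cm_zero K.
  apply: NNPP => W0.
  have : tseitin HK k (f i0) (f i0) (X i0) (tup (X i0) t0) = cm_zero K.
    rewrite -HW /marg (@finsumE _ HK _ _ [::]) //; first by constructor.
    move=> r ne; case: W0; exists r => Wr; apply: ne; rewrite Wr.
    by case: excluded_middle_informative.
  move=> Rt0; have := lsum_eq0 HK (x := t0) Rt0 (mem_In (mem_enum A t0)).
  by rewrite guardT // /weight f_id // t0sat eqxx.
(* By positivity the marginals of [W] do not vanish at the restrictions of [r], so each restriction
   comes from a solution. *)
have satr i : exists t, sat (f i) t /\ tup (X i) t = restr (sub_bigcup X i) r.
  apply: NNPP => no; apply: Wr; apply: (marg_eq0 (H := sub_bigcup X i) HK).
  rewrite HW; apply: (lsum_zero HK) => t _.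
  case: (excluded_middle_informative (tup (X i) t = restr (sub_bigcup X i) r)) => E;
    last by rewrite guardF.
  rewrite guardT // /weight; case: ifP => // /andP [st _].
  by case: no; exists t.
(* The default value zero is only taken outside the union of the hyperedges, where no equation
   looks. *)
pose T : A := [ffun v => odflt 0 (@enc V (fun=> F) _ r v)].
have lhsT i : i \in S -> lhs i T = (i == i0)%:R.
  move=> iS; have [t []] := satr i; rewrite f_id // => /eqP <- tr.
  apply: eq_bigr => v; rewrite inE => /andP [vi _]; congr (_ * _).
  rewrite ffunE (encT _ (subsetP (sub_bigcup X i) v vi)) /=.
  by have := f_equal (fun q => q v vi) tr.
have : \sum_(i in S) lhs i T = 1.
  rewrite (bigD1 i0) //= lhsT // eqxx big1 ?addr0 // => i /andP [iS /negPf ne].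
  by rewrite lhsT // ne.
(* Grouped by vertices, the left-hand sides cancel because the coefficients at each vertex sum to
   zero. *)
rewrite /lhs (exchange_big_dep (mem Y)) /=; last first.
  by move=> i v _; rewrite inE => /andP [].
rewrite big1 => [/esym/eqP|v vY]; first by rewrite oner_eq0.
transitivity ((\sum_(i in S | v \in X i) c i v) * T v); last first.
  by rewrite c_sum // mul0r.
by rewrite mulr_suml; apply: eq_bigl => i; rewrite !inE vY andbT.
Qed.

End Tseitin.

Lemma LTG_cover_not_stuck (K Ks : cmon) (h : Ks -> K) (V : finType) m
    (X : 'I_m -> {set V}) S Y :
  is_pcmonoid K -> is_cover h -> LTG_up_to h X -> covers X S Y -> ~ stuck X S Y.
Proof.
move=> HK [HKs [hom surj]] LTG cov HS; have [S1 deg _] := HS.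
(* A prime above the number of hyperedges exceeds the degree of every vertex, as balancing the
   coefficients requires. *)
have [p mp pp] := prime_above m.
have [c [c_unit c_sum]] : exists c : 'I_m -> V -> 'F_p,
    (forall i v, i \in S -> v \in X i -> v \in Y -> c i v != 0) /\
    (forall v, v \in Y -> \sum_(i in S | v \in X i) c i v = 0).
  have cv v : exists c : 'I_m -> 'F_p, v \in Y ->
      (forall i, i \in [set i in S | v \in X i] -> c i != 0) /\
      \sum_(i in [set i in S | v \in X i]) c i = 0.
    case: (boolP (v \in Y)) => vY; last by exists (fun=> 0).
    have [||c Hc] := @zero_sum_units p _ [set i in S | v \in X i] pp.
    - by apply: leq_trans (max_card _) _; rewrite card_ord ltnW.
    - exact: deg.
    by exists c.
  pose c i v := proj1_sig (constructive_indefinite_description _ (cv v)) i.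
  exists c; split=> [i v iS vi vY|v vY]; rewrite /c;
    case: constructive_indefinite_description => /= cc /(_ vY) [nz sm].
    by apply: nz; rewrite inE iS.
  by rewrite -[RHS]sm; apply: eq_bigl => i; rewrite inE.
have [i0 i0S] : exists i0, i0 \in S by apply/set0Pn; rewrite -card_gt0 ltnW.
have [f fP] : exists f : 'I_m -> 'I_m,
    forall i, f i \in S /\ X i :&: Y \subset X (f i).
  have ex i : exists j, j \in S /\ X i :&: Y \subset X j.
    by have [j jS ij] := cov i; exists j.
  exists (fun i => proj1_sig (constructive_indefinite_description _ (ex i))) => i.
  by case: constructive_indefinite_description.
have fS i := proj1 (fP i); have fX i := proj2 (fP i).
(* The system weighted by a preimage [k'] of a nonzero [k] is the lift: it is pairwise consistent in
   the cover, and [h] carries it to the system weighted by [k], which has no global witness. *)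
have [k k0] := pcmonoid_neq0 HK; have [k' hk'] := surj k.
apply: (tseitin_not_gl_consistent HS c_unit c_sum i0S fS fX (HK := HK) k0).
apply: LTG.
exists (fun i => tseitin X Y c i0 HKs k' (f i) (f i) (X i)); split; last first.
  exact: (tseitin_pw_consistent HS c_unit i0 fS fX).
move=> i t; rewrite /= lsum_hom //; apply: lsum_ext => s _.
rewrite guard_hom //; congr guard; rewrite /weight eqxx -hk'.
by case: ifP => // _; case: hom.
Qed.

End LinearEquations.

Theorem theorem46 (K : cmon) (HK : is_pcmonoid K) (V : finType) (m : nat)
  (X : 'I_m -> {set V}) :
  (acyclic X <-> LTG_up_to (@free_hom K) X) /\
  (LTG_up_to (@free_hom K) X <->
     exists (Ks : cmon) (h : Ks -> K), is_cover h /\ LTG_up_to h X).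
Proof.
(* Serves for the free cover and for an arbitrary one; an arbitrary cover then leads back to the
   free cover through acyclicity. *)
have cover_acyclic (Ks : cmon) (h : Ks -> K) :
    is_cover h -> LTG_up_to h X -> acyclic X.
  move=> hc LTG; apply: acyclic_of_not_stuck => S Y.
  exact: LTG_cover_not_stuck HK hc LTG.
split; split.
- exact: acyclic_LTG_free.
- exact: cover_acyclic (free_cover HK).
- by exists (free_mon K), (@free_hom K); split=> //; apply: free_cover.
- by case=> Ks [h [hc LTG]]; apply: acyclic_LTG_free => //; apply: cover_acyclic LTG.
Qed.
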